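(* Every instance of fair allocation of goods with additive valuations having $n \neq 3$ agents and $m \le n + 6$ goods admits an MMS allocation.
   Context: An instance of fair allocation of goods consists of a set $N=\{1,\dots,n\}$ of agents, a set $M=\{1,\dots,m\}$ of goods, and for each agent $i$ an additive valuation $v_i:2^M\to\mathbb{R}$ with $v_i(\emptyset)=0$, $v_i(S)=\sum_{g\in S}v_i(\{g\})$ and $v_i(\{g\})\ge 0$. An allocation is an ordered $n$-tuple $\langle A_1,\dots,A_n\rangle$ of pairwise disjoint (possibly empty) subsets of $M$ with union $M$. The maximin share of agent $i$ is $\mu_i=\max_{A}\min_{j} v_i(A_j)$ over all allocations $A$. An MMS allocation is an allocation with $v_i(A_i)\ge\mu_i$ for all $i$. *)

(* Defs.v *)
From mathcomp Require Import all_boot all_order all_algebra.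
Set Implicit Arguments. Unset Strict Implicit. Unset Printing Implicit Defensive.
Import Order.TTheory GRing.Theory Num.Theory.
Local Open Scope ring_scope.

Section FairDivision.
Variables (R : realFieldType) (n m : nat).

Definition valuation := 'I_n -> 'I_m -> R.

Definition bundle_value (v : valuation) (i : 'I_n) (S : {set 'I_m}) : R :=
  \sum_(g in S) v i g.

Definition is_allocation (A : {ffun 'I_n -> {set 'I_m}}) : bool :=
  [forall i, forall j, (i != j) ==> [disjoint A i & A j]]
  && (\bigcup_(i : 'I_n) A i == [set: 'I_m]).

(* min_j v_i(A_j).  The neutral element v_i(M) is an upper bound of every
   v_i(A_j), so it does not affect the minimum when n >= 1. *)
Definition min_share (v : valuation) (i : 'I_n) (A : {ffun 'I_n -> {set 'I_m}}) : R :=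
  \big[Order.min/bundle_value v i [set: 'I_m]]_(j : 'I_n) bundle_value v i (A j).

(* Maximin share mu_i = max over allocations A of min_j v_i(A_j).  The neutral
   element 0 is harmless since valuations are nonnegative and allocations
   exist when n >= 1. *)
Definition mms (v : valuation) (i : 'I_n) : R :=
  \big[Order.max/0]_(A : {ffun 'I_n -> {set 'I_m}} | is_allocation A) min_share v i A.

Definition is_MMS_allocation (v : valuation) (A : {ffun 'I_n -> {set 'I_m}}) : Prop :=
  is_allocation A /\ forall i : 'I_n, mms v i <= bundle_value v i (A i).

End FairDivision.

(* Main.v *)
(**
  Replacing each valuation by its decreasing rearrangement, we may assume that
  all agents rank the goods in the same order: an allocation of the ordered
  instance gives a picking sequence for the original one.  Then there are two
  ways to satisfy one agent with one or two goods while the others keep their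
  shares: hand over a single good that is enough for somebody, or, if there is
  none, a pair.  In the latter case every bundle of every partition has at
  least two goods, so m <= n + 6 forces many bundles of size two.  Unless
  somebody accepts the n-th and (n+1)-st goods, whose removal harms nobody,
  double counting yields a k < n such that all agents but at most one have a
  pair {k, y} in their partition; with y maximal, {k, y} can be removed for
  each of them, and the remaining agent either takes that pair or loses
  nothing when it goes.

  By induction this settles m <= n + 5, and m <= n + 6 except for n = 4 and
  m = 10 when some agent accepts the best good alone, as three agents and nine
  goods may be infeasible.  For three agents and nine goods let one of them
  divide.  If no allocation exists, the two others accept the same bundle of
  the divider only, and each of the two refused bundles meets every bundle of
  the others and is incomparable to it in the dominance order.  A finite check
  shows that this is possible for all three agents only if exactly one of them
  has a bundle of size two.  With four agents and ten goods, the agent who gets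
  the best good can be chosen so that this does not happen: agents refusing the
  best good have a spare good, which allows them to have a pair or not.
*)

Require Import Defs.
From mathcomp Require Import all_boot all_order all_algebra.
From mathcomp Require Import zify lra.
Import Order.TTheory GRing.Theory Num.Theory.
Local Open Scope ring_scope.

Set Implicit Arguments. Unset Strict Implicit. Unset Printing Implicit Defensive.

(** * The dominance order on bundles and the finite check *)

Notation cls f c G := [seq g <- G | f g == c].
Notation minus G S := [seq g <- G | g \notin S].

(* Goods are numbered from the best to the worst and bundles are increasing
   lists.  Nested [if]s rather than [&&]: [vm_compute] is strict and would evaluate
   both arguments of a conjunction. *)
Fixpoint dominates (S T : seq nat) : bool :=
  match S, T with
  | _, [::] => true
  | s :: S', t :: T' => if (s <= t)%N then dominates S' T' else false
  | [::], _ => false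
  end.

Lemma dominates_map (w : nat -> nat) (S T : seq nat) :
  {in S & T, forall x y, (x <= y)%N -> (w x <= w y)%N} ->
  dominates S T -> dominates (map w S) (map w T).
Proof.
elim: S T => [|s S IH] [|u T] //= mono.
case: ifP => // su /IH ->; last first.
  by move=> x y xS yT; apply: mono; rewrite inE ?xS ?yT orbT.
by rewrite mono ?inE ?eqxx.
Qed.

(** What an unsolvable instance forces between a refused bundle [S] and each bundle [B] of an agent
    refusing it; the reason is given at [class_transverse]. *)
Definition transverse (S B : seq nat) : bool :=
  if has (mem S) B then if dominates S B then false else ~~ dominates B S
  else false.

(* The first bundle is the one accepted by the other agents. *)
Definition bundles : Type := seq nat * seq nat * seq nat.

Definition opposed (P : bundles) (S : seq nat) : bool :=
  if transverse S P.1.1 then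
    if transverse S P.1.2 then transverse S P.2 else false
  else false.

Definition clash (P Q : bundles) : bool :=
  if opposed Q P.1.2 then
    if opposed Q P.2 then
      if opposed P Q.1.2 then opposed P Q.2 else false
    else false
  else false.

(** Ranks replace goods, so that one check over the ranks 0 to 8 serves every list of nine goods. *)
Definition positions (c : nat) (l : seq nat) : seq nat :=
  [seq k <- iota 0 (size l) | nth 3%N l k == c].

Definition bundles_of (l : seq nat) : bundles :=
  (positions 0 l, positions 1 l, positions 2 l).

Fixpoint colorings (n : nat) : seq (seq nat) :=
  if n is n'.+1 then
    flatten [seq [:: 0%N :: l; 1%N :: l; 2%N :: l] | l <- colorings n']
  else [:: [::]].

(** Refused bundles meet three disjoint bundles of another agent, hence have three goods or more.
    They cannot dominate the accepted bundle, which is worth more to those who refuse them. *)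
Definition admissible (P : bundles) : bool :=
  [&& (2 < size P.1.2)%N, (2 < size P.2)%N,
      ~~ dominates P.1.2 P.1.1 & ~~ dominates P.2 P.1.1].

(* Ordering the classes 1 and 2 by their best goods halves the search. *)
Definition candidates (k : nat) : seq bundles :=
  [seq P <- [seq bundles_of l | l <- colorings 9 & (index 1%N l < index 2%N l)%N]
   | (size P.1.1 == k) && admissible P].

Definition no_triangle (s1 s2 : seq bundles) : bool :=
  all (fun P => let s := filter (clash P) s1 in
     all (fun Q => ~~ has (clash Q) s) (filter (clash P) s2)) s1.

Lemma no_triangle3 : no_triangle (candidates 3) (candidates 3).
Proof. by vm_compute. Qed.

(** This excludes two or three accepted bundles of size two, and [no_triangle3] excludes none;
    exactly one remains possible. *)
Lemma no_triangle2 : no_triangle (candidates 2) (candidates 2 ++ candidates 3).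
Proof. by vm_compute. Qed.

Lemma no_triangleP (s1 s2 : seq bundles) : no_triangle s1 s2 ->
  forall P Q T, P \in s1 -> T \in s1 -> Q \in s2 ->
  clash P Q -> clash P T -> clash Q T -> False.
Proof.
move=> /allP no P Q T Ps Ts Qs PQ PT QT; move/allP: (no P Ps) => /(_ Q).
rewrite mem_filter PQ Qs => /(_ isT) /hasP; apply; exists T => //.
by rewrite mem_filter PT.
Qed.

Lemma transverseE (S B : seq nat) : transverse S B =
  [&& has (mem S) B, ~~ dominates S B & ~~ dominates B S].
Proof. by rewrite /transverse; case: has; case: dominates. Qed.

Lemma opposedE (P : bundles) (S : seq nat) :
  opposed P S = [&& transverse S P.1.1, transverse S P.1.2 & transverse S P.2].
Proof. by rewrite /opposed; case: transverse; case: transverse. Qed.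

Lemma clashE (P Q : bundles) : clash P Q =
  [&& opposed Q P.1.2, opposed Q P.2, opposed P Q.1.2 & opposed P Q.2].
Proof. by rewrite /clash; do 3![case: opposed => //=]. Qed.

(** The abstract family [C] keeps the enumerations out of the case analysis. Since [clash] is
    symmetric, two partitions from [C 2] can always play the two roles drawn from the first list. *)
Lemma triangle_count (C : nat -> seq bundles) :
  no_triangle (C 3) (C 3) -> no_triangle (C 2) (C 2 ++ C 3) ->
  forall k1 k2 k3 P Q T, k1 \in [:: 2%N; 3%N] -> k2 \in [:: 2%N; 3%N] ->
  k3 \in [:: 2%N; 3%N] -> P \in C k1 -> Q \in C k2 -> T \in C k3 ->
  clash P Q -> clash P T -> clash Q T ->
  ((k1 == 2) + (k2 == 2) + (k3 == 2) = 1)%N.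
Proof.
move=> /no_triangleP no3 /no_triangleP no2 k1 k2 k3 P Q T.
have sym P' Q' : clash P' Q' = clash Q' P'.
  rewrite !clashE; case: (opposed Q' P'.1.2); case: (opposed Q' P'.2) => //=;
  by rewrite ?andbT ?andbF.
rewrite !inE => /orP[]/eqP -> /orP[]/eqP -> /orP[]/eqP -> // PC QC TC PQ PT QT; exfalso.
- by apply: (no2 P Q T); rewrite ?mem_cat ?QC.
- by apply: (no2 P T Q); rewrite ?mem_cat ?TC ?orbT // sym.
- by apply: (no2 P Q T); rewrite ?mem_cat ?QC ?orbT.
- by apply: (no2 Q P T); rewrite ?mem_cat ?PC ?orbT // sym.
- exact: (no3 P Q T).
Qed.

Lemma mem_colorings (n : nat) (l : seq nat) :
  size l = n -> all (fun c => c < 3)%N l -> l \in colorings n.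
Proof.
elim: n l => [|n IH] [|c l] //= [/IH sz] /andP[c3 /sz lC].
apply/flatten_mapP; exists l => //; rewrite !inE.
by case: c c3 => [|[|[|]]] // _; rewrite eqxx ?orbT.
Qed.

(** * Ordered instances *)

Section Goods.

Variables (R : realFieldType) (I : eqType) (v : I -> nat -> R) (t : I -> R).
Hypothesis v_ge0 : forall i g, 0 <= v i g.
Hypothesis v_anti : forall i g g', (g <= g')%N -> v i g' <= v i g.

Definition value (i : I) (S : seq nat) : R := \sum_(g <- S) v i g.

Definition fair (i : I) (k : nat) (G : seq nat) (f : nat -> nat) : Prop :=
  forall c, (c < k)%N -> t i <= value i (cls f c G).

(** This stands in for the maximin share: the thresholds [t i] stay fixed during the induction, and
    only the ability to split the remaining goods has to be maintained. *)
Definition splits (i : I) (k : nat) (G : seq nat) : Prop := exists f, fair i k G f.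

(** An owner function makes the bundles disjoint by construction; goods whose owner lies outside [N]
    are wasted. *)
Definition satisfiable (N : seq I) (G : seq nat) : Prop :=
  exists h : nat -> I, {in N, forall i, t i <= value i (cls h i G)}.

Lemma value_ge0 i S : 0 <= value i S.
Proof. exact: sumr_ge0. Qed.

Lemma value_nil i : value i [::] = 0.
Proof. exact: big_nil. Qed.

Lemma value_cons i g S : value i (g :: S) = v i g + value i S.
Proof. exact: big_cons. Qed.

Lemma value_filter i (p : pred nat) G :
  value i (filter p G) = \sum_(g <- G) (if p g then v i g else 0).
Proof. by rewrite /value big_filter big_mkcond. Qed.

Lemma value_predC i (p : pred nat) G :
  value i G = value i (filter p G) + value i (filter (predC p) G).
Proof.
rewrite !value_filter -big_split /=; apply: eq_bigr => g _.
by case: (p g); rewrite ?addr0 ?add0r.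
Qed.

Lemma value_sub i (p q : pred nat) G :
  {in G, forall g, p g -> q g} -> value i (filter p G) <= value i (filter q G).
Proof.
move=> pq; rewrite !value_filter big_seq [leRHS]big_seq; apply: ler_sum => g gG.
by case: ifP => [/(pq g gG) -> //|_]; case: ifP.
Qed.

Lemma value_dominates i S T : dominates S T -> value i T <= value i S.
Proof.
elim: S T => [|s S IH] [|u T] //=.
- by rewrite value_nil value_ge0.
case: ifP => // su /IH STle; rewrite !value_cons lerD // v_anti //.
Qed.

Lemma value_subset i (S G : seq nat) : uniq S -> uniq G -> {subset S <= G} ->
  value i S = value i (filter (mem S) G).
Proof.
move=> uS uG SG; apply: perm_big; apply: uniq_perm => //; first exact: filter_uniq.
move=> x; rewrite mem_filter /=; apply/idP/andP => [xS|[] //].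
by split=> //; apply: SG.
Qed.

(* Colours [>= k] stand for unallocated goods; they can be merged into colour 0. *)
Lemma fair_total i k G : (0 < k)%N -> splits i k G ->
  exists f, fair i k G f /\ forall g, (f g < k)%N.
Proof.
move=> k0 [f fair_f]; exists (fun g => if (f g < k)%N then f g else 0%N); split.
  move=> c ck; apply: le_trans (fair_f c ck) _; apply: value_sub => g _ /eqP fg.
  by rewrite fg ck eqxx.
by move=> g; case: ifP.
Qed.

(** Colours are renumbered by their index in [C]; all others get index [k], that is, become
    unallocated. *)
Lemma splits_colors i k G f (C : seq nat) : uniq C -> size C = k ->
  {in C, forall c, t i <= value i (cls f c G)} -> splits i k G.
Proof.
move=> uC <- good; exists (fun g => index (f g) C) => c cC.
apply: le_trans (good _ (mem_nth 0%N cC)) _; apply: value_sub => g _ /eqP ->.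
by rewrite index_uniq.
Qed.

Lemma splits_value i k G : splits i k G -> t i *+ k <= value i G.
Proof.
case=> f; elim: k G => [|k IH] G fair_f; first by rewrite mulr0n value_ge0.
rewrite (value_predC i (fun g => f g == k) G) mulrS lerD ?fair_f //.
apply: IH => c ck; apply: le_trans (fair_f c (ltnW ck)) _.
rewrite -filter_predI; apply: value_sub => g _ /= /eqP ->.
by rewrite eqxx neq_ltn ck.
Qed.

Lemma satisfiable_perm N N' G : N =i N' -> satisfiable N G -> satisfiable N' G.
Proof. by move=> NN [h sat_h]; exists h => i; rewrite -NN; apply: sat_h. Qed.

Lemma satisfiable_give N G (S : seq nat) i : i \in N ->
  t i <= value i (filter (mem S) G) ->
  satisfiable [seq j <- N | j != i] (minus G S) -> satisfiable N G.
Proof.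
move=> iN iS [h sat_h]; exists (fun g => if g \in S then i else h g) => j jN.
have [ji|ji] := eqVneq j i.
  rewrite ji; apply: le_trans iS _; apply: value_sub => g _ /= -> //.
apply: le_trans (sat_h j _) _; first by rewrite mem_filter ji.
by rewrite -filter_predI; apply: value_sub => g _ /= /andP[/eqP -> /negPf ->].
Qed.

(** * Removing goods at the cost of one class *)

Lemma filter_mem_class G (f : nat -> nat) c : filter (mem (cls f c G)) G = cls f c G.
Proof. by apply: eq_in_filter => g gG /=; rewrite mem_filter gG andbT. Qed.

Lemma splits_drop i k G f (S : seq nat) c : (c < k)%N ->
  (forall d, (d < k)%N -> d != c -> t i <= value i (cls f d G)) ->
  {in S, forall g, f g = c} -> splits i k.-1 (minus G S).
Proof.
move=> ck good Sc; apply: (@splits_colors i k.-1 _ f (rem c (iota 0 k))).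
- by rewrite rem_uniq // iota_uniq.
- by rewrite size_rem ?size_iota // mem_iota.
move=> d; rewrite mem_rem_uniq ?iota_uniq // !inE mem_iota /= add0n => /andP[dc dk].
apply: le_trans (good d dk dc) _; rewrite -filter_predI; apply: value_sub => g _ /=.
move=> /eqP fg; rewrite fg eqxx /=; apply/negP => /Sc; rewrite fg => /eqP.
by rewrite (negPf dc).
Qed.

(* Two classes together are worth [2 t i], so they survive the loss of [S]
   as a single class. *)
Lemma splits_merge i k G f (S : seq nat) c d : fair i k G f -> (c < k)%N -> (d < k)%N ->
  c != d -> {in S, forall g, f g \in [:: c; d]} ->
  value i (filter (mem S) G) <= t i -> splits i k.-1 (minus G S).
Proof.
move=> fair_f ck dk cd Scd Sle.
pose f' g := if f g == d then c else f g.
apply: (@splits_colors i k.-1 _ f' (rem d (iota 0 k))).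
- by rewrite rem_uniq // iota_uniq.
- by rewrite size_rem ?size_iota // mem_iota.
move=> e; rewrite mem_rem_uniq ?iota_uniq // !inE mem_iota /= add0n => /andP[ed ek].
have [->|ec] := eqVneq e c.
  have le2 : t i + t i <= value i (cls f' c G).
    apply: le_trans (lerD (fair_f c ck) (fair_f d dk)) _.
    rewrite !value_filter -big_split; apply: ler_sum => g _ /=; rewrite /f'.
    have [->|fd] := eqVneq (f g) d; last by rewrite addr0.
    by rewrite eq_sym (negPf cd) add0r eqxx.
  have : value i (filter (mem S) (cls f' c G)) <= t i.
    apply: le_trans Sle; rewrite -filter_predI; apply: value_sub => g _ /=.
    by case/andP.
  have -> : cls f' c (minus G S) = filter (predC (mem S)) (cls f' c G).
    by rewrite -!filter_predI; apply: eq_filter => g /=; rewrite andbC.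
  have := value_predC i (mem S) (cls f' c G); lra.
apply: le_trans (fair_f e ek) _; rewrite -filter_predI; apply: value_sub => g _ /=.
move=> /eqP fg; rewrite /f' fg (negPf ed) eqxx /=; apply/negP => /Scd.
by rewrite fg !inE (negPf ed) (negPf ec).
Qed.

Definition swap_colors (f : nat -> nat) (x y g : nat) : nat :=
  if g == x then f y else if g == y then f x else f g.

(** Only the class of [x] can lose: any other class either keeps its goods or trades [y] for the
    better [x]. *)
Lemma value_swap i G f x y d : uniq G -> x \in G -> y \in G -> (x <= y)%N ->
  f x != d ->
  value i (cls f d G) <= value i (cls (swap_colors f x y) d G).
Proof.
move=> uG xG yG xy fxd; have [yx|yx] := eqVneq y x.
  apply: value_sub => g _; rewrite /swap_colors yx.
  by have [->|] := eqVneq g x.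
have yG' : y \in rem x G by rewrite mem_rem_uniq // !inE yx.
rewrite !value_filter !(perm_big _ (perm_to_rem xG)) !big_cons.
rewrite !(perm_big _ (perm_to_rem yG')) !big_cons /= /swap_colors !eqxx.
rewrite (negPf yx) (negPf fxd) !add0r lerD //.
  by case: ifP => // _; apply: v_anti.
rewrite big_seq [leRHS]big_seq; apply: ler_sum => g.
rewrite mem_rem_uniq ?rem_uniq // !inE mem_rem_uniq // !inE.
by move=> /andP[/negPf -> /andP[/negPf -> _]].
Qed.

(* The elements of [P], all of colour [c], are exchanged with those of [S] from
   the last to the first: since both lists increase, a later exchange neither
   recolours an element of [S] already treated nor disturbs an element of [P]
   still to be treated. *)
Lemma swap_dominated i G (f : nat -> nat) c (P S : seq nat) : sorted ltn P -> sorted ltn S ->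
  uniq G -> {subset P <= G} -> {subset S <= G} ->
  {in P, forall g, f g = c} -> dominates P S ->
  exists f', [/\ forall d, d != c -> value i (cls f d G) <= value i (cls f' d G),
                 {in S, forall g, f' g = c} &
                 forall g, g \notin P -> g \notin S -> f' g = f g].
Proof.
move=> + + uG; elim: P S => [|p P IH] [|s S] // Ps Ss PG SG Pc; try by exists f.
move=> /=; case: ifP => // ps PS.
move: Ps Ss; rewrite /= !(path_sortedE ltn_trans) => /andP[pP sP] /andP[sS sS'].
have [|||f1 [f1_le f1S f1E]] := IH S sP sS' _ _ _ PS.
- by move=> g gP; apply: PG; rewrite inE gP orbT.
- by move=> g gS; apply: SG; rewrite inE gS orbT.
- by move=> g gP; apply: Pc; rewrite inE gP orbT.
have f1p : f1 p = c.
  rewrite f1E ?Pc ?inE ?eqxx //; apply/negP.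
    by move=> /(allP pP); rewrite /= ltnn.
  by move=> /(allP sS) /= sp; move: ps; rewrite leqNgt sp.
exists (swap_colors f1 p s); split.
- move=> d dc; apply: le_trans (f1_le d dc) _; apply: value_swap => //.
  + by apply: PG; rewrite inE eqxx.
  + by apply: SG; rewrite inE eqxx.
  + by rewrite f1p eq_sym.
- move=> g; rewrite inE /swap_colors => /orP[/eqP ->|gS].
    by case: eqP => [-> //|]; rewrite eqxx.
  have sg : (s < g)%N := allP sS _ gS.
  by rewrite !gtn_eqF ?f1S // (leq_ltn_trans ps).
move=> g; rewrite !inE !negb_or /swap_colors => /andP[/negPf -> gP] /andP[/negPf -> gS].
exact: f1E.
Qed.

(** After exchanging [P] for [S], class [c] contains [S] and is given up with it, while no other
    class has lost value. *)
Lemma splits_swap i k G f c (P S : seq nat) : fair i k G f -> (c < k)%N ->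
  sorted ltn P -> sorted ltn S -> uniq G -> {subset P <= G} -> {subset S <= G} ->
  {in P, forall g, f g = c} -> dominates P S -> splits i k.-1 (minus G S).
Proof.
move=> fair_f ck sP sS uG PG SG Pc PS.
have [f' [f'_le f'S _]] := swap_dominated i sP sS uG PG SG Pc PS.
apply: (splits_drop ck _ f'S) => d dk dc.
exact: le_trans (fair_f d dk) (f'_le d dc).
Qed.

Lemma satisfiable1 i G : splits i 1 G -> satisfiable [:: i] G.
Proof.
move=> /splits_value; rewrite mulr1n => le_t; exists (fun=> i) => j.
rewrite inE => /eqP ->; apply: le_trans le_t _.
by rewrite (eq_filter (a2 := predT)) ?filter_predT // => g; rewrite /= eqxx.
Qed.

Lemma cut_and_choose i j G : i != j -> splits i 2 G -> t j *+ 2 <= value j G ->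
  satisfiable [:: i; j] G.
Proof.
move=> ij /fair_total[] // f [fair_f f2] jG.
have f01 g : f g = 0%N \/ f g = 1%N by case: (f g) (f2 g) => [|[|]]; auto.
have : t j <= value j (cls f 0%N G) \/ t j <= value j (cls f 1%N G).
  have := value_predC j (fun g => f g == 0%N) G.
  rewrite (eq_filter (a1 := predC _) (a2 := fun g => f g == 1%N)); last first.
    by move=> g /=; case: (f01 g) => ->.
  case: (lerP (t j) (value j (cls f 0%N G))); first by left.
  right; lra.
have pick c d : (c < 2)%N -> (d < 2)%N -> c != d -> t j <= value j (cls f c G) ->
    satisfiable [:: i; j] G.
  move=> c2 d2 cd jc; exists (fun g => if f g == d then i else j) => l.
  rewrite !inE => /orP[] /eqP ->.
    apply: le_trans (fair_f d d2) _; apply: value_sub => g _ ->; exact: eqxx.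
  apply: le_trans jc _; apply: value_sub => g _ /eqP ->.
  by rewrite (negPf cd) eqxx.
by case; [apply: (pick 0%N 1%N)|apply: (pick 1%N 0%N)].
Qed.

Lemma splits_small i k G (S : seq nat) : (size S <= 1)%N -> (0 < k)%N ->
  splits i k G -> splits i k.-1 (minus G S).
Proof.
move=> S1 k0 /(fair_total k0)[f [fair_f fk]].
case: S S1 => [|g [|]] // _.
  (* With nothing to remove, any class may be dropped. *)
  apply: (splits_drop (c := k.-1) (f := f)) => //; first by rewrite ltn_predL.
  by move=> d dk _; apply: fair_f.
apply: (splits_drop (c := f g) (f := f)) => //.
- by move=> d dk _; apply: fair_f.
- by move=> x; rewrite inE => /eqP ->.
Qed.

Lemma value_minus i (G S : seq nat) :
  value i G = value i (filter (mem S) G) + value i (minus G S).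
Proof. exact: value_predC. Qed.

(** * Colourings with three colours *)

Lemma classes3 (f : nat -> nat) : (forall g, f g < 3)%N ->
  forall g, [\/ f g = 0%N, f g = 1%N | f g = 2%N].
Proof.
move=> f3 g; case: (f g) (f3 g) => [|[|[|]]] // _.
- exact: Or31.
- exact: Or32.
- exact: Or33.
Qed.

Lemma value_classes3 i G (f : nat -> nat) : (forall g, f g < 3)%N ->
  value i G = value i (cls f 0%N G) + value i (cls f 1%N G) + value i (cls f 2%N G).
Proof.
move=> f3; rewrite !value_filter -!big_split; apply: eq_bigr => g _ /=.
by case: (classes3 f3 g) => -> /=; rewrite ?addr0 ?add0r.
Qed.

Lemma liked_class i G (f : nat -> nat) : (forall g, f g < 3)%N ->
  t i *+ 3 <= value i G -> exists2 p, (p < 3)%N & t i <= value i (cls f p G).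
Proof.
move=> f3; rewrite (value_classes3 i G f3) => le3.
case: (lerP (t i) (value i (cls f 0%N G))) => [|lt0]; first by exists 0%N.
case: (lerP (t i) (value i (cls f 1%N G))) => [|lt1]; first by exists 1%N.
exists 2%N => //; lra.
Qed.

Lemma size_classes3 (G : seq nat) (f : nat -> nat) : (forall g, f g < 3)%N ->
  (size (cls f 0%N G) + size (cls f 1%N G) + size (cls f 2%N G))%N = size G.
Proof.
move=> f3; rewrite !size_filter; elim: G => //= g s.
by case: (classes3 f3 g) => -> /=; lia.
Qed.

Definition profile (f : nat -> nat) (G : seq nat) : seq nat :=
  [seq size (cls f c G) | c <- iota 0 3].

(** * Three agents and nine goods *)

Section Trio.

Variables (G : seq nat).
Hypothesis uG : uniq G.

(* [a] takes the bundle [S], [b] cuts the rest and [c] chooses. *)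
Lemma trio_removal a b c (S : seq nat) : uniq [:: a; b; c] ->
  t a <= value a (filter (mem S) G) -> splits b 2 (minus G S) ->
  t c *+ 2 <= value c (minus G S) -> satisfiable [:: a; b; c] G.
Proof.
move=> /=; rewrite !inE negb_or => /and3P[/andP[ab ac] bc _] aS bS cS.
apply: (satisfiable_give (i := a) (S := S)); rewrite ?inE ?eqxx //=.
rewrite eqxx !(eq_sym _ a) (negPf ab) (negPf ac); exact: cut_and_choose.
Qed.

Lemma trio_small a b c f p : uniq [:: a; b; c] -> fair a 3 G f -> (p < 3)%N ->
  splits b 3 G -> splits c 3 G -> (size (cls f p G) <= 1)%N ->
  satisfiable [:: a; b; c] G.
Proof.
move=> uabc fair_f p3 sb sc small; apply: (trio_removal (S := cls f p G)) => //.
- by rewrite filter_mem_class fair_f.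
- exact: (splits_small small _ sb).
- exact/splits_value/(splits_small small _ sc).
Qed.

Lemma trio_distinct a b c f q r : uniq [:: a; b; c] -> fair a 3 G f ->
  (q < 3)%N -> (r < 3)%N -> q != r ->
  t b <= value b (cls f q G) -> t c <= value c (cls f r G) ->
  satisfiable [:: a; b; c] G.
Proof.
move=> uabc fair_f q3 r3 qr bq cr.
have [p [p3 pq pr]] : exists p, [/\ (p < 3)%N, p != q & p != r].
  move: qr; case: q q3 {bq} => [|[|[|]]] // _; case: r r3 {cr} => [|[|[|]]] // _ _;
  by [exists 0%N|exists 1%N|exists 2%N].
exists (fun g => if f g == q then b else if f g == r then c else a) => i.
have liked j s : t j <= value j (cls f s G) ->
    (forall g, f g = s -> (if f g == q then b else if f g == r then c else a) = j) ->
    t j <= value j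
      [seq g <- G | (if f g == q then b else if f g == r then c else a) == j].
  move=> js E; apply: le_trans js _; apply: value_sub => g _ /eqP fs.
  by apply/eqP/E.
rewrite !inE => /or3P[] /eqP ->.
- apply: (liked a p (fair_f p p3)) => g ->.
  by rewrite (negPf pq) (negPf pr).
- by apply: (liked b q) => // g ->; rewrite eqxx.
- by apply: (liked c r) => // g ->; rewrite eq_sym (negPf qr) eqxx.
Qed.

(** Each of [b] and [c] accepts some class of the divider [a]. If they can be served by different
    classes, [a] takes the third; otherwise both accept one and the same class and nothing else. *)
Lemma lone_divider a b c f : uniq [:: a; b; c] -> fair a 3 G f ->
  (forall g, f g < 3)%N -> splits b 3 G -> splits c 3 G ->
  satisfiable [:: a; b; c] G \/
  exists2 q, (q < 3)%N & {in [:: b; c], forall j, t j <= value j (cls f q G) /\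
    forall p, (p < 3)%N -> p != q -> value j (cls f p G) < t j}.
Proof.
move=> uabc fair_f f3 /splits_value vb /splits_value vc.
have [q q3 bq] := liked_class f3 vb; have [r r3 cr] := liked_class f3 vc.
have [qr|qr] := eqVneq q r; last by left; apply: (trio_distinct uabc fair_f _ _ qr).
have [/hasP[p]|/hasPn no] := boolP (has (fun p => (p != q) &&
    ((t b <= value b (cls f p G)) || (t c <= value c (cls f p G)))) (iota 0 3)).
  rewrite mem_iota /= => p3 /andP[pq /orP[bp|cp]]; left.
    by apply: (trio_distinct uabc fair_f p3 q3) => //; rewrite qr.
  by apply: (trio_distinct uabc fair_f q3 p3) => //; rewrite eq_sym.
right; exists q => // j; rewrite !inE => jI.
have dis p : (p < 3)%N -> p != q ->
    value b (cls f p G) < t b /\ value c (cls f p G) < t c.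
  move=> p3 pq; have := no p; rewrite mem_iota pq p3 /= => /(_ isT).
  by rewrite negb_or -!ltNge => /andP[].
by case/orP: jI => /eqP ->; split; rewrite ?bq ?qr // => p p3; rewrite -?qr => /(dis p p3)[].
Qed.

(** The only class sizes left when nine goods admit no solution; see [class_candidate]. *)
Definition balanced (f : nat -> nat) : bool :=
  all (fun s => 1 < s < 5)%N (profile f G).

(** Normal form for the finite check: the accepted class becomes colour 0, and of the two others the
    one with the better best good becomes colour 1. The profile is only permuted, so its balance and
    its pairs are unchanged. *)
Lemma designated a b c f : uniq [:: a; b; c] -> fair a 3 G f ->
  (forall g, f g < 3)%N -> splits b 3 G -> splits c 3 G ->
  satisfiable [:: a; b; c] G \/
  exists f', [/\ fair a 3 G f', forall g, (f' g < 3)%N,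
    perm_eq (profile f G) (profile f' G),
    (index 1%N (map f' G) <= index 2%N (map f' G))%N &
    {in [:: b; c], forall j, t j <= value j (cls f' 0%N G) /\
    forall p, (0 < p < 3)%N -> value j (cls f' p G) < t j}].
Proof.
move=> uabc fair_f f3 sb sc.
have [|[q q3 qP]] := lone_divider uabc fair_f f3 sb sc; [by left|right].
(* [s] lists the old colours in the order of their new names. *)
have relabel (s : seq nat) : perm_eq (iota 0 3) s -> nth 0%N s 0 = q ->
    (index (nth 0%N s 1) (map f G) <= index (nth 0%N s 2) (map f G))%N ->
  exists f', [/\ fair a 3 G f', forall g, (f' g < 3)%N,
    perm_eq (profile f G) (profile f' G),
    (index 1%N (map f' G) <= index 2%N (map f' G))%N &
    {in [:: b; c], forall j, t j <= value j (cls f' 0%N G) /\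
    forall p, (0 < p < 3)%N -> value j (cls f' p G) < t j}].
  move=> s_perm s0 s12; have us : uniq s by rewrite -(perm_uniq s_perm).
  have szs : size s = 3 by rewrite -(perm_size s_perm).
  have fs g : f g \in s by rewrite -(perm_mem s_perm) mem_iota f3.
  pose f' g := index (f g) s.
  have E k : (k < 3)%N -> (fun g => f' g == k) =1 (fun g => f g == nth 0%N s k).
    move=> k3 g; apply/eqP/eqP => [<-|E]; first by rewrite nth_index.
    by rewrite /f' E index_uniq ?szs.
  have clsE k : (k < 3)%N -> cls f' k G = cls f (nth 0%N s k) G.
    by move=> k3; apply: eq_filter; apply: E.
  have s3 k : (k < 3)%N -> (nth 0%N s k < 3)%N.
    move=> k3; have := mem_nth 0%N (_ : k < size s)%N.
    by rewrite -(perm_mem s_perm) mem_iota szs; apply.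
  exists f'; split.
  - by move=> k k3; rewrite clsE ?fair_f ?s3.
  - by move=> g; have := fs g; rewrite -index_mem szs.
  - rewrite [profile f' G](_ : _ = [seq size (cls f c G) | c <- s]) ?perm_map //.
    rewrite -[in RHS](mkseq_nth 0%N s) /mkseq szs -map_comp; apply/eq_in_map => k.
    by rewrite mem_iota => k3 /=; rewrite clsE.
  - have idx k : (k < 3)%N -> index k (map f' G) = index (nth 0%N s k) (map f G).
      by move=> k3; rewrite /index !find_map; apply: eq_find => g; apply: E.
    by rewrite !idx.
  - move=> j jI; have [likes dislikes] := qP j jI; split; first by rewrite clsE // s0.
    move=> p /andP[p0 p3]; rewrite clsE //; apply: dislikes; first exact: s3.
    by rewrite -s0 nth_uniq ?szs // -lt0n.
pose r1 := nth 0%N (rem q (iota 0 3)) 0; pose r2 := nth 0%N (rem q (iota 0 3)) 1.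
have [le12|/ltnW le21] := leqP (index r1 (map f G)) (index r2 (map f G)).
  apply: (relabel [:: q; r1; r2]) => //.
  by rewrite /r1 /r2; case: (q) q3 => [|[|[|]]].
apply: (relabel [:: q; r2; r1]) => //.
by rewrite /r1 /r2; case: (q) q3 => [|[|[|]]].
Qed.

(** Give the refused class [S] to [a]. Then [c] still values the rest at twice its share, so it
    suffices that [b] can halve the rest. It can if [S] misses a class of [b], by merging the two
    others, or if such a class dominates [S], by exchange. And [S] dominates no class of [b], being
    worth less than the share of [b]. *)
Lemma class_transverse a b c fa fb p r : uniq [:: a; b; c] ->
  fair a 3 G fa -> fair b 3 G fb -> (forall g, fb g < 3)%N -> splits c 3 G ->
  (p < 3)%N -> (r < 3)%N -> sorted ltn G ->
  value b (cls fa p G) < t b -> value c (cls fa p G) < t c ->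
  satisfiable [:: a; b; c] G \/ transverse (cls fa p G) (cls fb r G).
Proof.
move=> uabc fair_a fair_b fb3 sc p3 r3 sG bp cp; set S := cls fa p G.
have remove : splits b 2 (minus G S) -> satisfiable [:: a; b; c] G.
  move=> sb; apply: (trio_removal uabc _ sb); first by rewrite filter_mem_class fair_a.
  have := splits_value sc; rewrite (value_minus c G S) filter_mem_class; lra.
rewrite transverseE; have [hit|/hasPn miss] := boolP (has _ _); last first.
  left; apply: remove.
  pose c1 := nth 0%N (rem r (iota 0 3)) 0; pose c2 := nth 0%N (rem r (iota 0 3)) 1.
  have [c13 c23 c12 c12P] : [/\ (c1 < 3)%N, (c2 < 3)%N, c1 != c2 &
      forall s, (s < 3)%N -> s != r -> s \in [:: c1; c2]].
    rewrite /c1 /c2; case: (r) r3 => [|[|[|]]] // _; split=> //;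
    by case=> [|[|[|]]].
  apply: (splits_merge (k := 3) fair_b c13 c23 c12); last by rewrite filter_mem_class ltW.
  move=> g gS; apply: c12P => //; apply/negP => /eqP fbg.
  have gG : g \in G by move: gS; rewrite mem_filter => /andP[].
  by have := miss g; rewrite mem_filter fbg eqxx gG => /(_ isT)/negP; apply.
have [SB|_] := boolP (dominates S _).
  by have := le_trans (fair_b r r3) (value_dominates b SB); rewrite leNgt bp.
have [BS|_] := boolP (dominates _ S); last by right.
have sub (f : nat -> nat) s : {subset cls f s G <= G} by move=> g; rewrite mem_filter => /andP[].
left; apply: remove; apply: (splits_swap (k := 3) fair_b r3 _ _ uG _ _ _ BS) => //.
- exact: (sorted_filter ltn_trans).
- exact: (sorted_filter ltn_trans).
- exact: sub.
- by move=> g; rewrite mem_filter => /andP[/eqP].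
Qed.

Lemma positions_class f c : sorted ltn G -> (c < 3)%N ->
  cls f c G = map (nth 0%N G) (positions c (map f G)).
Proof.
move=> sG c3; rewrite -{1}[G](mkseq_nth 0%N) filter_map /positions size_map.
congr map; apply: eq_in_filter => k; rewrite mem_iota /= add0n => kG.
by rewrite (nth_map 0%N).
Qed.

Hypothesis sG : sorted ltn G.

Lemma nth_leq k l : (l < size G)%N -> (k <= l)%N -> (nth 0%N G k <= nth 0%N G l)%N.
Proof.
move=> lG kl; apply: (sorted_leq_nth leq_trans leqnn) => //.
- by apply: sub_sorted sG => x y; apply: ltnW.
- by rewrite inE (leq_ltn_trans kl).
Qed.

Lemma positions_lt c (f : nat -> nat) k : k \in positions c (map f G) -> (k < size G)%N.
Proof. by rewrite mem_filter mem_iota size_map => /andP[_]. Qed.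

Lemma dominates_positions f g c d : (c < 3)%N -> (d < 3)%N ->
  dominates (positions c (map f G)) (positions d (map g G)) ->
  dominates (cls f c G) (cls g d G).
Proof.
move=> c3 d3; rewrite !positions_class //; apply: dominates_map.
by move=> x y _ /positions_lt yG; apply: nth_leq.
Qed.

Lemma transverse_positions f g c d : (c < 3)%N -> (d < 3)%N ->
  transverse (cls f c G) (cls g d G) ->
  transverse (positions c (map f G)) (positions d (map g G)).
Proof.
move=> c3 d3; rewrite !transverseE => /and3P[/hasP[x xg xf] nd nd'].
apply/and3P; split; last 2 first.
- by apply: contra nd; apply: dominates_positions.
- by apply: contra nd'; apply: dominates_positions.
move: xg xf; rewrite /= !positions_class // => /mapP[k kg ->] /mapP[l lf].
move/eqP; rewrite nth_uniq ?(positions_lt kg) ?(positions_lt lf) // => /eqP kl.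
by apply/hasP; exists k => //=; rewrite kl.
Qed.

Lemma class_opposed a b c fa fb p : uniq [:: a; b; c] ->
  fair a 3 G fa -> fair b 3 G fb -> (forall g, fb g < 3)%N -> splits c 3 G ->
  (p < 3)%N -> value b (cls fa p G) < t b -> value c (cls fa p G) < t c ->
  satisfiable [:: a; b; c] G \/
  opposed (bundles_of (map fb G)) (positions p (map fa G)).
Proof.
move=> uabc fair_a fair_b fb3 sc p3 bp cp.
have tr r : (r < 3)%N -> satisfiable [:: a; b; c] G \/
    transverse (positions p (map fa G)) (positions r (map fb G)).
  move=> r3; have := class_transverse uabc fair_a fair_b fb3 sc p3 r3 sG bp cp.
  by case=> [|/transverse_positions tr]; [left|right; apply: tr].
rewrite opposedE /=.
case: (tr 0%N isT) => [|->]; first by left.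
case: (tr 1%N isT) => [|->]; first by left.
by case: (tr 2%N isT) => [|->]; [left|right].
Qed.

(** [S] meets three pairwise disjoint classes. *)
Lemma opposed_size l S : opposed (bundles_of l) S -> (2 < size S)%N.
Proof.
rewrite opposedE !transverseE /= -!andbA.
move=> /and4P[/hasP[x x0 xS] _ _ /and4P[/hasP[y y1 yS] _ _ /andP[/hasP[z z2 zS] _]]].
apply: (@uniq_leq_size _ [:: x; y; z]); last first.
  by move=> w; rewrite !inE => /or3P[] /eqP ->.
move: x0 y1 z2; rewrite !mem_filter => /andP[/eqP x0 _] /andP[/eqP y1 _] /andP[/eqP z2 _].
have xy : x != y by apply/eqP => E; rewrite E y1 in x0.
have xz : x != z by apply/eqP => E; rewrite E z2 in x0.
have yz : y != z by apply/eqP => E; rewrite E z2 in y1.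
by rewrite /= !inE negb_or xy xz yz.
Qed.

Lemma size_class f c : (c < 3)%N -> size (cls f c G) = size (positions c (map f G)).
Proof. by move=> c3; rewrite positions_class // size_map. Qed.

(** The accepted class has at least two goods, or [trio_small] applies; the refused ones have at
    least three each. Nine goods leave size 2 or 3 for the accepted class and at most 4 for the
    others. *)
Lemma class_candidate a b c fa fb : uniq [:: a; b; c] -> size G = 9%N ->
  fair a 3 G fa -> (forall g, fa g < 3)%N ->
  (index 1%N (map fa G) <= index 2%N (map fa G))%N ->
  splits b 3 G -> splits c 3 G ->
  t b <= value b (cls fa 0%N G) ->
  (forall p, (0 < p < 3)%N -> value b (cls fa p G) < t b) ->
  opposed (bundles_of (map fb G)) (positions 1 (map fa G)) ->
  opposed (bundles_of (map fb G)) (positions 2 (map fa G)) ->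
  satisfiable [:: a; b; c] G \/
  exists2 k, k \in [:: 2%N; 3%N] &
    bundles_of (map fa G) \in candidates k /\
    (balanced fa /\ (2%N \in profile fa G) = (k == 2%N)).
Proof.
move=> uabc G9 fair_a fa3 le12 sb sc bq bp op1 op2.
have [small|large] := leqP (size (cls fa 0%N G)) 1.
  by left; apply: (trio_small uabc fair_a _ sb sc small).
have sum9 := size_classes3 G fa3; rewrite G9 !size_class // in sum9 large.
have s1 := opposed_size op1; have s2 := opposed_size op2.
right; exists (size (positions 0 (map fa G))).
  move: (size (positions 0 _)) (size (positions 1 _)) (size (positions 2 _)) sum9 large s1 s2
       => x y z; rewrite !inE; lia.
split; last first.
  split.
    rewrite /balanced /profile /= !size_class //.
    move: (size (positions 0 _)) (size (positions 1 _)) (size (positions 2 _)) sum9 large s1 s2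
       => x y z; lia.
  by rewrite /profile /= !size_class // !inE (ltn_eqF s1) (ltn_eqF s2) !orbF eq_sym.
have nodom p : (0 < p < 3)%N ->
    ~~ dominates (positions p (map fa G)) (positions 0 (map fa G)).
  move=> p03; have /andP[_ p3] := p03; apply/negP => /(dominates_positions p3 (isT : 0 < 3)%N).
  by move=> /(value_dominates b); rewrite leNgt (lt_le_trans (bp p p03)).
rewrite mem_filter; apply/andP; split.
  by rewrite eqxx /admissible s1 s2 !nodom.
apply/mapP; exists (map fa G) => //; rewrite mem_filter mem_colorings ?size_map // ?andbT; last first.
  by apply/allP => c' /mapP[g _ ->].
(* Class 1 is nonempty, so equal indices would give its best good both colours 1 and 2. *)
rewrite ltn_neqAle le12 andbT; apply/negP => /eqP E12.
have in1 : 1%N \in map fa G.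
  case E : (positions 1 (map fa G)) s1 => [|k s] // _.
  have : k \in positions 1 (map fa G) by rewrite E mem_head.
  rewrite mem_filter mem_iota => /andP[/eqP <- k9]; exact: mem_nth.
have := nth_index 3%N in1; rewrite E12 nth_index //.
by rewrite -index_mem -E12 index_mem.
Qed.

(** Each agent divides in turn. Failing a solution, the three normalised partitions are candidates
    that clash pairwise, and the finite check counts the pairs. *)
Lemma trio_sat a b c : uniq [:: a; b; c] -> size G = 9%N ->
  forall fa fb fc, fair a 3 G fa -> fair b 3 G fb -> fair c 3 G fc ->
  (forall g, (fa g < 3)%N) -> (forall g, (fb g < 3)%N) -> (forall g, (fc g < 3)%N) ->
  satisfiable [:: a; b; c] G \/
  [/\ balanced fa, balanced fb, balanced fc &
     ((2%N \in profile fa G) + (2%N \in profile fb G) + (2%N \in profile fc G) = 1)%N].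
Proof.
move=> uabc G9 fa fb fc Fa Fb Fc fa3 fb3 fc3.
have permE N' : perm_eq [:: a; b; c] N' ->
    uniq N' /\ (satisfiable N' G -> satisfiable [:: a; b; c] G).
  move=> pN; split; first by rewrite -(perm_uniq pN).
  by apply: satisfiable_perm => i; rewrite (perm_mem pN).
have [ubac satb] : uniq [:: b; a; c] /\ (satisfiable [:: b; a; c] G -> satisfiable [:: a; b; c] G).
  by apply: permE; apply/permP => p /=; do 3!case: (p _).
have [ucab satc] : uniq [:: c; a; b] /\ (satisfiable [:: c; a; b] G -> satisfiable [:: a; b; c] G).
  by apply: permE; apply/permP => p /=; do 3!case: (p _).
have [uacb sata'] : uniq [:: a; c; b] /\ (satisfiable [:: a; c; b] G -> satisfiable [:: a; b; c] G).
  by apply: permE; apply/permP => p /=; do 3!case: (p _).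
have [ubca satb'] : uniq [:: b; c; a] /\ (satisfiable [:: b; c; a] G -> satisfiable [:: a; b; c] G).
  by apply: permE; apply/permP => p /=; do 3!case: (p _).
have [ucba satc'] : uniq [:: c; b; a] /\ (satisfiable [:: c; b; a] G -> satisfiable [:: a; b; c] G).
  by apply: permE; apply/permP => p /=; do 3!case: (p _).
have Sa : splits a 3 G by exists fa.
have Sb : splits b 3 G by exists fb.
have Sc : splits c 3 G by exists fc.
have bal f f' : perm_eq (profile f G) (profile f' G) -> balanced f = balanced f'.
  by move=> E; apply: perm_all.
have pair f f' : perm_eq (profile f G) (profile f' G) ->
    (2%N \in profile f G) = (2%N \in profile f' G).
  by move=> E; apply: perm_mem.
have [|[ga [Ga ga3 /[dup] /bal -> /pair -> ia]]] := designated uabc Fa fa3 Sb Sc.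
  by left.
move=> /[dup] /(_ b (mem_head _ _))[ab0 abp] /(_ c).
rewrite inE mem_head orbT => /(_ isT)[ac0 acp].
have [/satb|[gb [Gb gb3 /[dup] /bal -> /pair -> ib]]] := designated ubac Fb fb3 Sa Sc.
  by left.
move=> /[dup] /(_ a (mem_head _ _))[ba0 bap] /(_ c).
rewrite inE mem_head orbT => /(_ isT)[bc0 bcp].
have [/satc|[gc [Gc gc3 /[dup] /bal -> /pair -> ic]]] := designated ucab Fc fc3 Sa Sb.
  by left.
move=> /[dup] /(_ a (mem_head _ _))[ca0 cap] /(_ b).
rewrite inE mem_head orbT => /(_ isT)[cb0 cbp].
pose B f := bundles_of (map f G).
have opp i j k f g p : uniq [:: i; j; k] ->
    (satisfiable [:: i; j; k] G -> satisfiable [:: a; b; c] G) ->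
    fair i 3 G f -> fair j 3 G g -> (forall x, g x < 3)%N -> splits k 3 G ->
    (0 < p < 3)%N ->
    (forall p, (0 < p < 3)%N -> value j (cls f p G) < t j) ->
    (forall p, (0 < p < 3)%N -> value k (cls f p G) < t k) ->
    satisfiable [:: a; b; c] G \/ opposed (B g) (positions p (map f G)).
  move=> u sat Fi Fj g3 Sk p03 jp kp; have /andP[_ p3] := p03.
  by have [/sat|] := class_opposed u Fi Fj g3 Sk p3 (jp p p03) (kp p p03); [left|right].
have [|oab1] := opp a b c ga gb 1%N uabc id Ga Gb gb3 Sc isT abp acp; first by left.
have [|oab2] := opp a b c ga gb 2 uabc id Ga Gb gb3 Sc isT abp acp; first by left.
have [|oac1] := opp a c b ga gc 1%N uacb sata' Ga Gc gc3 Sb isT acp abp; first by left.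
have [|oac2] := opp a c b ga gc 2 uacb sata' Ga Gc gc3 Sb isT acp abp; first by left.
have [|oba1] := opp b a c gb ga 1%N ubac satb Gb Ga ga3 Sc isT bap bcp; first by left.
have [|oba2] := opp b a c gb ga 2 ubac satb Gb Ga ga3 Sc isT bap bcp; first by left.
have [|obc1] := opp b c a gb gc 1%N ubca satb' Gb Gc gc3 Sa isT bcp bap; first by left.
have [|obc2] := opp b c a gb gc 2 ubca satb' Gb Gc gc3 Sa isT bcp bap; first by left.
have [|oca1] := opp c a b gc ga 1%N ucab satc Gc Ga ga3 Sb isT cap cbp; first by left.
have [|oca2] := opp c a b gc ga 2 ucab satc Gc Ga ga3 Sb isT cap cbp; first by left.
have [|ocb1] := opp c b a gc gb 1%N ucba satc' Gc Gb gb3 Sa isT cbp cap; first by left.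
have [|ocb2] := opp c b a gc gb 2 ucba satc' Gc Gb gb3 Sa isT cbp cap; first by left.
have [|[ka ka23 [Ca [-> ->]]]] :=
  class_candidate uabc G9 Ga ga3 ia Sb Sc ab0 abp oab1 oab2; first by left.
have [/satb|[kb kb23 [Cb [-> ->]]]] :=
  class_candidate ubac G9 Gb gb3 ib Sa Sc ba0 bap oba1 oba2; first by left.
have [/satc|[kc kc23 [Cc [-> ->]]]] :=
  class_candidate ucab G9 Gc gc3 ic Sa Sb ca0 cap oca1 oca2; first by left.
have Kab : clash (B ga) (B gb) by rewrite clashE oab1 oab2 oba1 oba2.
have Kac : clash (B ga) (B gc) by rewrite clashE oac1 oac2 oca1 oca2.
have Kbc : clash (B gb) (B gc) by rewrite clashE obc1 obc2 ocb1 ocb2.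
right; split=> //.
exact: (triangle_count no_triangle3 no_triangle2 ka23 kb23 kc23 Ca Cb Cc Kab Kac Kbc).
Qed.

End Trio.
(** Choice over a finite list, obtained by induction without an axiom. *)
Lemma seq_choice (T : Type) (x0 : T) (P : I -> T -> Prop) (N : seq I) :
  {in N, forall i, exists x, P i x} -> exists F, {in N, forall i, P i (F i)}.
Proof.
elim: N => [|i N IH] exP; first by exists (fun=> x0).
have [j jN|F FP] := IH; first by apply: exP; rewrite inE jN orbT.
have [x Px] := exP i (mem_head _ _).
exists (fun j => if j == i then x else F j) => j; rewrite inE.
by case: eqP => [->|_] //=; apply: FP.
Qed.

Lemma seq_argmax (K : seq I) (y : I -> nat) : (0 < size K)%N ->
  exists2 i, i \in K & {in K, forall j, (y j <= y i)%N}.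
Proof.
elim: K => // i [|j K] IH _.
  by exists i => [|k]; rewrite ?inE // => /eqP ->.
have [//|l lK lmax] := IH; have [il|li] := leqP (y i) (y l).
  exists l => [|k]; rewrite in_cons ?lK ?orbT // => /orP[/eqP -> //|]; exact: lmax.
exists i => [|k]; rewrite in_cons ?eqxx // => /orP[/eqP -> //|/lmax kl].
exact: leq_trans kl (ltnW li).
Qed.

(** * Removing a pair *)

Section Pairs.

Variables (N : seq I) (G : seq nat) (n : nat).
Hypotheses (uN : uniq N) (Nn : size N = n) (sG : sorted ltn G).

Let uG : uniq G := sorted_uniq ltn_trans ltnn sG.

Lemma value_pair i x y : (x < y)%N -> x \in G -> y \in G ->
  value i (filter (mem [:: x; y]) G) = v i x + v i y.
Proof.
move=> xy xG yG; rewrite -value_subset //; last 1 first.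
- by move=> z; rewrite !inE => /orP[] /eqP ->.
- by rewrite !value_cons value_nil addr0.
- by rewrite /= inE ltn_eqF.
Qed.

(** The pair of [x] and [z], inside one class, dominates the pair of [x] and [y]. *)
Lemma splits_pair_class i f x z y : fair i n G f -> (f x < n)%N -> (x < z <= y)%N ->
  x \in G -> z \in G -> y \in G -> f z = f x -> splits i n.-1 (minus G [:: x; y]).
Proof.
move=> fair_f fx /andP[xz zy] xG zG yG fz.
apply: (splits_swap (P := [:: x; z]) (c := f x) fair_f) => //=.
- by rewrite xz.
- by rewrite (leq_trans xz zy).
- by move=> w; rewrite !inE => /orP[] /eqP ->.
- by move=> w; rewrite !inE => /orP[] /eqP ->.
- by move=> w; rewrite !inE => /orP[] /eqP ->.
- by rewrite leqnn zy.
Qed.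

Lemma splits_pair_disliked i f x y : fair i n G f -> (forall g, (f g < n)%N) ->
  (1 < n)%N -> (x < y)%N -> x \in G -> y \in G -> v i x + v i y <= t i ->
  splits i n.-1 (minus G [:: x; y]).
Proof.
move=> fair_f fn n1 xy xG yG le_t.
have [d [dn fxd Sd]] : exists d, [/\ (d < n)%N, f x != d &
    {in [:: x; y], forall g, f g \in [:: f x; d]}].
  have [E|E] := eqVneq (f x) (f y); last first.
    by exists (f y); split=> // g; rewrite !inE => /orP[] /eqP ->; rewrite eqxx ?orbT.
  (* Both goods lie in one class, so any second class can be merged with it. *)
  exists (if f x == 0%N then 1%N else 0%N); split.
  - by case: ifP => //; rewrite (ltnW n1).
  - by case: ifP => [/eqP -> //|->].
  by move=> g; rewrite !inE => /orP[] /eqP ->; rewrite ?E eqxx.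
by apply: (splits_merge fair_f (fn x) dn fxd Sd); rewrite value_pair.
Qed.

Hypothesis t_gt0 : {in N, forall i, 0 < t i}.
Hypothesis no_single : {in N & G, forall i g, v i g < t i}.

Lemma class_size i f c : i \in N -> fair i n G f -> (c < n)%N ->
  (1 < size (cls f c G))%N.
Proof.
move=> iN fair_f cn; have := fair_f c cn.
have : {subset cls f c G <= G} by move=> g; rewrite mem_filter => /andP[].
case: (cls f c G) => [|x [|y s]] //= sub.
  by rewrite value_nil leNgt t_gt0.
by rewrite value_cons value_nil addr0 leNgt no_single // sub ?mem_head.
Qed.

Lemma size_classes (f : nat -> nat) : (forall g, (f g < n)%N) ->
  (\sum_(c <- iota 0 n) size (cls f c G) = size G)%N.
Proof.
move=> fn; elim: (G) => [|g s IH]; first by rewrite big1.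
transitivity (\sum_(c <- iota 0 n) ((f g == c) + size (cls f c s)))%N.
  by apply: eq_bigr => c _ /=; case: ifP.
rewrite big_split /= IH -[RHS]add1n; congr addn.
rewrite (bigD1_seq (f g)) ?mem_iota ?iota_uniq //= eqxx big1 // => c.
by rewrite eq_sym => /negPf ->.
Qed.

(** Every class has at least two goods, so each one contributes 3 or more once a class of size two
    is counted with one extra unit. *)
Lemma pair_classes i f : i \in N -> fair i n G f -> (forall g, (f g < n)%N) ->
  (3 * n <= count (fun c => size (cls f c G) == 2%N) (iota 0 n) + size G)%N.
Proof.
move=> iN fair_f fn; rewrite -(size_classes fn) -sum1_count big_mkcond -big_split /=.
have : (\sum_(c <- iota 0 n) 3 <= \sum_(c <- iota 0 n)
    ((if size (cls f c G) == 2%N then 1 else 0) + size (cls f c G)))%N.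
  rewrite big_seq [leqRHS]big_seq; apply: leq_sum => c; rewrite mem_iota => cn.
  have := class_size iN fair_f cn; case: eqP => [-> //|]; lia.
by rewrite big_const_seq count_predT size_iota iter_addn_0 mulnC.
Qed.

(* Two of the first [n + 1] goods lie in the same class. *)
Lemma low_pair i : (2 * n <= size G)%N -> (1 < n)%N -> i \in N ->
  {in N, forall j, splits j n G} ->
  t i <= v i (nth 0%N G n.-1) + v i (nth 0%N G n) ->
  {in N, forall j, splits j n.-1 (minus G [:: nth 0%N G n.-1; nth 0%N G n])}.
Proof.
move=> n2 n1 iN all_split liked j jN.
have [f [fair_f fn]] := fair_total (ltnW n1) (all_split j jN).
have nG : (n < size G)%N by lia.
have inG k : (k <= n)%N -> nth 0%N G k \in G.
  by move=> kn; apply: mem_nth; apply: leq_ltn_trans nG.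
have : ~~ uniq [seq f (nth 0%N G k) | k <- iota 0 n.+1].
  apply/negP => /(@uniq_leq_size _ _ (iota 0 n)); rewrite size_map !size_iota ltnn.
  by move/(_ _)/negP; apply=> // _ /mapP[k _ ->]; rewrite mem_iota fn.
case/(uniqPn 0%N) => p [q []]; rewrite size_map size_iota => pq qn.
rewrite !(nth_map 0%N) ?size_iota ?(ltn_trans pq) // !nth_iota ?(ltn_trans pq) // !add0n.
move=> fpq; have pn : (p <= n.-1)%N by lia.
have ltG k l : (k < l)%N -> (l <= n)%N -> (nth 0%N G k < nth 0%N G l)%N.
  move=> kl ln; apply: (sorted_ltn_nth ltn_trans 0%N sG) => //; rewrite inE; lia.
have leG k l : (k <= l)%N -> (l <= n)%N -> (nth 0%N G k <= nth 0%N G l)%N.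
  by rewrite leq_eqVlt => /orP[/eqP -> //|kl ln]; apply/ltnW/ltG.
have sub2 k l : (k <= n)%N -> (l <= n)%N ->
    {subset [:: nth 0%N G k; nth 0%N G l] <= G}.
  by move=> kn ln g; rewrite !inE => /orP[] /eqP ->; apply: inG.
apply: (splits_swap (P := [:: nth 0%N G p; nth 0%N G q]) (c := f (nth 0%N G p)) fair_f) => //.
- by rewrite /= ltG.
- by rewrite /= ltG // ltn_predL ltnW.
- by apply: sub2; lia.
- by apply: sub2; lia.
- by move=> g; rewrite !inE => /orP[] /eqP ->.
- by rewrite /= !leG //; lia.
Qed.

Definition partner i f x y : bool :=
  [&& (x < y)%N, f y == f x :> nat & t i <= v i x + v i y].

(** Classes of size two are counted by the position of their better good, which determines the
    class. It is below [n.-1]: otherwise the pair would be worth at most the goods at [n.-1] and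
    [n], which fall short of the share. *)
Lemma pair_minima i f : (2 * n <= size G)%N -> (1 < n)%N -> i \in N ->
  fair i n G f -> (forall g, (f g < n)%N) ->
  v i (nth 0%N G n.-1) + v i (nth 0%N G n) < t i ->
  (3 * n <= count (fun k => has (partner i f (nth 0%N G k)) G) (iota 0 n.-1)
    + size G)%N.
Proof.
move=> n2 n1 iN fair_f fn low; apply: leq_trans (pair_classes iN fair_f fn) _.
rewrite leq_add2r -!size_filter.
set C := [seq c <- _ | _]; pose pos c := index (head 0%N (cls f c G)) G.
have CP c : c \in C -> exists x y, [/\ cls f c G = [:: x; y],
    x \in G /\ y \in G, f x = c, f y = c & (x < y)%N /\ t i <= v i x + v i y].
  rewrite mem_filter mem_iota => /andP[/eqP sz cn].
  have := fair_f c cn; have : sorted ltn (cls f c G) := sorted_filter ltn_trans _ sG.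
  have : {in cls f c G, forall g, g \in G /\ f g = c}.
    by move=> g; rewrite mem_filter => /andP[/eqP].
  case: (cls f c G) sz => [|x [|y [|]]] // _ inE' /= /andP[xy _] le_t.
  have [xG fx] := inE' x (mem_head _ _).
  have [|yG fy] := inE' y; first by rewrite !inE eqxx orbT.
  exists x, y; split=> //; split=> //.
  by move: le_t; rewrite !value_cons value_nil addr0.
have posK c : c \in C -> f (nth 0%N G (pos c)) = c.
  by move=> /CP[x [y [E [xG _] fx _ _]]]; rewrite /pos E /= nth_index.
rewrite -(size_map pos); apply: uniq_leq_size.
  rewrite map_inj_in_uniq ?filter_uniq ?iota_uniq // => c d cC dC E.
  by rewrite -(posK c cC) E posK.
move=> _ /mapP[c cC ->]; have [x [y [E [xG yG] fx fy [xy le_t]]]] := CP c cC.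
have px : nth 0%N G (pos c) = x by rewrite /pos E /= nth_index.
have posG : (pos c < size G)%N by rewrite /pos E /= index_mem.
rewrite mem_filter px mem_iota; apply/andP; split.
  by apply/hasP; exists y => //; rewrite /partner xy fx fy eqxx.
rewrite /= add0n ltnNge; apply/negP => np; move: low; rewrite ltNge => /negP; apply.
apply: le_trans le_t _; rewrite lerD // v_anti //.
  rewrite -px; apply: (sorted_leq_nth leq_trans leqnn) => //; rewrite ?inE; try lia.
  by apply: sub_sorted sG => u w; apply: ltnW.
rewrite -(nth_index 0%N yG); apply: (sorted_leq_nth leq_trans leqnn) => //.
- by apply: sub_sorted sG => u w; apply: ltnW.
- by rewrite inE; lia.
- by rewrite inE index_mem.
apply: (@leq_trans (pos c).+1); first lia.
rewrite ltnNge; apply/negP => yx; move: xy; rewrite ltnNge => /negP; apply.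
rewrite -px -(nth_index 0%N yG); apply: (sorted_leq_nth leq_trans leqnn) => //.
- by apply: sub_sorted sG => u w; apply: ltnW.
- by rewrite inE index_mem.
Qed.

Lemma give_pair : (1 < n)%N -> (2 * n <= size G)%N ->
  (n.-1 * n.-2 + n * size G < n * (3 * n))%N ->
  {in N, forall i, splits i n G} ->
  exists i x y, [/\ i \in N, (x < y)%N, x \in G /\ y \in G, t i <= v i x + v i y &
    {in N, forall j, j != i -> splits j n.-1 (minus G [:: x; y])}].
Proof.
move=> n1 n2 many all_split.
have nG : (n < size G)%N by lia.
have [/hasP[i iN low]|/hasPn high] :=
    boolP (has (fun i => t i <= v i (nth 0%N G n.-1) + v i (nth 0%N G n)) N).
  exists i, (nth 0%N G n.-1), (nth 0%N G n); split=> //.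
  - by apply: (sorted_ltn_nth ltn_trans 0%N sG); rewrite ?inE; lia.
  - by split; apply: mem_nth => //; apply: leq_ltn_trans nG; apply: leq_pred.
  - by move=> j jN _; apply: (low_pair n2 n1 iN all_split low).
have [F FP] : exists F : I -> nat -> nat, {in N, forall i, fair i n G (F i) /\
    forall g, (F i g < n)%N}.
  apply: (@seq_choice _ (fun=> 0%N) (fun i f => fair i n G f /\ forall g, (f g < n)%N)).
  by move=> i iN; apply/fair_total/all_split => //; apply: ltnW.
pose b i k := has (partner i (F i) (nth 0%N G k)) G.
(* Double counting of agents and positions: if each of the [n.-1] positions served at most [n.-2]
   agents, the total would be at most [n.-1 * n.-2], against the hypothesis [many]. *)
have [k kn Kbig] : exists2 k, (k < n.-1)%N & (n.-1 <= count (b^~ k) N)%N.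
  have [/hasP[k]|/hasPn small] := boolP (has (fun k => n.-1 <= count (b^~ k) N)%N (iota 0 n.-1)).
    by rewrite mem_iota => kn; exists k.
  have le1 : (\sum_(i <- N) count (b i) (iota 0 n.-1) <= n.-1 * n.-2)%N.
    rewrite (eq_bigr (fun i => \sum_(k <- iota 0 n.-1) (b i k : nat))%N); last first.
      by move=> i _; rewrite -sum1_count big_mkcond; apply: eq_bigr => k _; case: (b i k).
    rewrite exchange_big /=.
    apply: leq_trans (_ : \sum_(k <- iota 0 n.-1) n.-2 <= _)%N; last first.
      by rewrite big_const_seq count_predT size_iota iter_addn_0 mulnC.
    rewrite big_seq [leqRHS]big_seq; apply: leq_sum => k /small.
    rewrite (_ : (\sum_(i <- N) (b i k : nat))%N = count (b^~ k) N); first by lia.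
    by rewrite -sum1_count [RHS]big_mkcond; apply: eq_bigr => i _; case: (b i k).
  have le2 : (n * (3 * n) <= \sum_(i <- N) (count (b i) (iota 0 n.-1) + size G))%N.
    apply: leq_trans (_ : \sum_(i <- N) (3 * n) <= _)%N.
      by rewrite big_const_seq count_predT Nn iter_addn_0 mulnC.
    rewrite big_seq [leqRHS]big_seq; apply: leq_sum => i iN.
    have [fair_F Fn] := FP i iN; apply: pair_minima => //.
    by rewrite ltNge high.
  move: le2; rewrite big_split /= big_const_seq count_predT Nn iter_addn_0 => le2.
  by move: many; rewrite ltnNge (leq_trans le2) // mulnC leq_add2r.
set x := nth 0%N G k; have xG : x \in G.
  exact/mem_nth/(ltn_trans (leq_trans kn (leq_pred n)) nG).
pose K := [seq i <- N | b i k]; pose P i := [seq y <- G | partner i (F i) x y].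
have Ksize : (n.-1 <= size K)%N by rewrite size_filter.
have KN : {subset K <= N} by move=> i; rewrite mem_filter => /andP[].
have PP i : i \in K -> head 0%N (P i) \in G /\ partner i (F i) x (head 0%N (P i)).
  rewrite mem_filter /b has_filter -/x -/(P i) => /andP[Pi _].
  have : head 0%N (P i) \in P i by case: (P i) Pi => // y s _; apply: mem_head.
  by rewrite mem_filter => /andP[].
(* The worst of the chosen partners is removed with [x], so that every agent in [K] has a partner at
   least as good. *)
have [|i0 i0K i0max] := @seq_argmax K (fun i => head 0%N (P i)); first by lia.
set y := head 0%N (P i0) in i0max *.
have [yG /and3P[xy _ i0_likes]] := PP i0 i0K.
have inK j : j \in K -> splits j n.-1 (minus G [:: x; y]).
  move=> jK; have [zG /and3P[xz /eqP fz _]] := PP j jK.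
  have [fair_F Fn] := FP j (KN j jK).
  by apply: (splits_pair_class fair_F (Fn x) _ xG zG yG fz); rewrite xz i0max.
(* At most one agent is outside [K]. If it accepts the pair, it takes it and all others are in [K];
   if not, [i0] takes the pair, and the outsider loses at most its share, absorbed by a merge. *)
have [/hasP[e eN /andP[eK e_likes]]|/hasPn noe] :=
    boolP (has (fun e => (e \notin K) && (t e <= v e x + v e y)) N).
  exists e, x, y; split=> // j jN je; apply: inK.
  have ueK : uniq (e :: K) by rewrite /= eK filter_uniq.
  have eKN : {subset e :: K <= N}.
    by move=> l; rewrite inE => /orP[/eqP -> //|/KN].
  have [|_ E] := uniq_min_size ueK eKN; first by rewrite Nn (leq_trans (leqSpred n)).
  by have := jN; rewrite -E inE (negPf je).
exists i0, x, y; split=> //; first exact: KN.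
move=> j jN _; have [/inK //|jK] := boolP (j \in K).
have [fair_F Fn] := FP j jN.
apply: (splits_pair_disliked fair_F Fn n1 xy xG yG).
by have := noe j jN; rewrite jK /= -ltNge => /ltW.
Qed.

End Pairs.
(** * Induction on the number of agents *)

Lemma size_minus (G S : seq nat) : uniq G -> uniq S -> {subset S <= G} ->
  (size (minus G S) + size S = size G)%N.
Proof.
move=> uG uS SG; rewrite -(count_predC (mem S) G) addnC size_filter; congr addn.
rewrite -size_filter; apply/perm_size/uniq_perm => //; first exact: filter_uniq.
move=> x; rewrite mem_filter /=; apply/idP/andP => [xS|[] //].
by split=> //; apply: SG.
Qed.

Lemma sorted_minus (G S : seq nat) : sorted ltn G -> sorted ltn (minus G S).
Proof. exact: (sorted_filter ltn_trans). Qed.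

Lemma size_others (N : seq I) i : uniq N -> i \in N ->
  size [seq j <- N | j != i] = (size N).-1.
Proof. by move=> uN iN; rewrite -rem_filter ?size_rem. Qed.

Definition solvable (n m : nat) : Prop := forall (N : seq I) (G : seq nat),
  uniq N -> size N = n -> sorted ltn G -> (size G <= m)%N ->
  {in N, forall i, splits i n G} -> satisfiable N G.

Lemma solvable_le n m m' : (m <= m')%N -> solvable n m' -> solvable n m.
Proof.
by move=> mm S N G uN Nn sG Gm; apply: S => //; apply: leq_trans Gm mm.
Qed.

Lemma solvable1 m : solvable 1 m.
Proof.
move=> [|i [|]] // G _ _ _ _ sp; apply: satisfiable1.
by apply: sp; apply: mem_head.
Qed.

Lemma solvable2 m : solvable 2 m.
Proof.
move=> [|i [|j [|]]] // G; rewrite /= inE andbT => ij _ _ _ sp.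
apply: cut_and_choose => //; first by apply: sp; apply: mem_head.
by apply/splits_value/sp; rewrite !inE eqxx orbT.
Qed.

Lemma value_single i (G : seq nat) g : uniq G -> g \in G ->
  value i (filter (mem [:: g]) G) = v i g.
Proof.
move=> uG gG; rewrite -value_subset //; first by rewrite value_cons value_nil addr0.
by move=> x; rewrite inE => /eqP ->.
Qed.

Lemma satisfiable_single n m (N : seq I) (G : seq nat) i g :
  solvable n.-1 m.-1 -> uniq N -> size N = n -> sorted ltn G -> (size G <= m)%N ->
  {in N, forall i, splits i n G} -> i \in N -> g \in G -> t i <= v i g ->
  satisfiable N G.
Proof.
move=> S uN Nn sG Gm sp iN gG ig; have uG := sorted_uniq ltn_trans ltnn sG.
have n0 : (0 < n)%N by rewrite -Nn; case: (N) iN.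
apply: (satisfiable_give (S := [:: g]) iN); first by rewrite value_single.
apply: S.
- exact: filter_uniq.
- by rewrite size_others ?Nn.
- exact: sorted_minus.
- have := @size_minus G [:: g] uG isT; rewrite addn1 => E; move: Gm; rewrite -E.
    by case: (m).
  by move=> x; rewrite inE => /eqP ->.
- by move=> j; rewrite mem_filter => /andP[_ /sp]; apply: splits_small.
Qed.

(** The case of an agent content with one good is left as a hypothesis, because four agents and ten
    goods need their own argument there. *)
Lemma solvable_pair n m : (1 < n)%N ->
  (n.-1 * n.-2 + n * m < n * (3 * n))%N -> solvable n.-1 m.-2 ->
  (forall (N : seq I) (G : seq nat) i g, uniq N -> size N = n -> sorted ltn G ->
     (size G <= m)%N -> {in N, forall i, splits i n G} -> i \in N -> g \in G ->
     t i <= v i g -> satisfiable N G) ->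
  solvable n m.
Proof.
move=> n1 nm S single N G uN Nn sG Gm sp; have uG := sorted_uniq ltn_trans ltnn sG.
have [/hasP[i iN /hasP[g gG ig]]|/hasPn no] :=
    boolP (has (fun i => has (fun g => t i <= v i g) G) N).
  exact: (single N G i g).
have no_single : {in N & G, forall i g, v i g < t i}.
  by move=> i g iN gG; have /hasPn/(_ g gG) := no i iN; rewrite -ltNge.
case: (posnP (size G)) => [G0|G0].
  case: N uN Nn sp {no no_single} => [|i0 N] uN Nn sp; first by rewrite -Nn in n1.
  exists (fun=> i0) => i iN; have [f fair_f] := sp i iN.
  (* Without goods no share is positive, so any owner function is a solution. *)
  have := fair_f 0%N (ltnW n1); rewrite (size0nil G0) /= !value_nil //.
have t_gt0 : {in N, forall i, 0 < t i}.
  move=> i iN; apply: le_lt_trans (no_single i (nth 0%N G 0) iN _) => //.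
  exact: mem_nth.
have [i0 i0N] : exists i, i \in N.
  by case: (N) Nn n1 => [<- //|i N' _ _]; exists i; apply: mem_head.
have n2 : (2 * n <= size G)%N.
  have [f [fair_f fn]] := fair_total (ltnW n1) (sp i0 i0N).
  rewrite -(size_classes G fn); apply: leq_trans (_ : \sum_(c <- iota 0 n) 2 <= _)%N.
    by rewrite big_const_seq count_predT size_iota iter_addn_0.
  rewrite big_seq [leqRHS]big_seq; apply: leq_sum => c; rewrite mem_iota => cn.
  exact: (class_size t_gt0 no_single i0N fair_f cn).
have nG : (n.-1 * n.-2 + n * size G < n * (3 * n))%N.
  by apply: leq_ltn_trans nm; rewrite leq_add2l leq_mul2l Gm orbT.
have [i [x [y [iN xy [xG yG] ixy others]]]] :=
  give_pair uN Nn sG t_gt0 no_single n1 n2 nG sp.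
have xyG : {subset [:: x; y] <= G} by move=> g; rewrite !inE => /orP[] /eqP ->.
have uxy : uniq [:: x; y] by rewrite /= inE ltn_eqF.
apply: (satisfiable_give (S := [:: x; y]) iN); first by rewrite value_pair.
apply: S.
- exact: filter_uniq.
- by rewrite size_others ?Nn.
- exact: sorted_minus.
- have := size_minus uG uxy xyG; rewrite /= addn2 => E; move: Gm; rewrite -E.
  by case: (m) => [|[|m']].
- by move=> j; rewrite mem_filter => /andP[ji jN]; apply: others.
Qed.

Lemma solvable_step n m : (1 < n)%N ->
  (n.-1 * n.-2 + n * m < n * (3 * n))%N -> solvable n.-1 m.-1 -> solvable n m.
Proof.
move=> n1 nm S; apply: (solvable_pair n1 nm).
  by apply: solvable_le S; case: (m) => [|[|]].
by move=> N G i g uN Nn sG Gm sp iN gG ig; apply: (satisfiable_single S uN Nn sG Gm sp iN gG ig).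
Qed.

(** The counting condition reads $n^2 > 2n + 2$, which holds from $n = 3$ on. *)
Lemma solvable_plus5 n : (0 < n)%N -> solvable n (n + 5).
Proof.
elim: n => // [[|[|n]]] IH _; [exact: solvable1|exact: solvable2|].
apply: solvable_step => //; first by rewrite /=; nia.
by have := IH isT; rewrite !addSn.
Qed.

(** * Four agents and ten goods *)

Definition recolor (f : nat -> nat) (s r g : nat) : nat := if g == s then r else f g.

Lemma fair_recolor i k G f s r : fair i k (minus G [:: s]) f -> fair i k G (recolor f s r).
Proof.
move=> fair_f c ck; apply: le_trans (fair_f c ck) _.
rewrite -filter_predI; apply: value_sub => g _ /= /andP[/eqP <-].
by rewrite inE /recolor => /negPf ->.
Qed.

Lemma size_recolor (G : seq nat) f s r c : uniq G -> s \in G ->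
  size (cls (recolor f s r) c G) = (size (cls f c (minus G [:: s])) + (r == c))%N.
Proof.
move=> uG sG; rewrite -filter_predI !size_filter.
have /permP -> := perm_to_rem sG; rewrite /= [in LHS]/recolor eqxx addnC; congr addn.
have /permP -> := perm_to_rem sG; rewrite /= inE eqxx andbF add0n.
apply: eq_in_count => g; rewrite mem_rem_uniq // !inE /recolor => /andP[/negPf -> _].
by rewrite andbT.
Qed.

(* Eight goods in three classes: the ninth can be added so as to keep a pair,
   or so as to destroy it, unless this makes the colouring unbalanced. *)
Lemma spare_good i (G : seq nat) f s : uniq G -> s \in G -> size G = 9%N ->
  fair i 3 (minus G [:: s]) f -> (forall g, (f g < 3)%N) ->
  forall b : bool, exists f', [/\ fair i 3 G f', forall g, (f' g < 3)%N &
    balanced G f' -> (2%N \in profile f' G) = b].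
Proof.
move=> uG sG G9 fair_f f3 b.
have sum8 := size_classes3 (minus G [:: s]) f3.
have sz8 : size (minus G [:: s]) = 8%N.
  have := @size_minus G [:: s] uG isT; rewrite G9 addn1 => E.
  by apply: succn_inj; apply: E => g; rewrite inE => /eqP ->.
rewrite sz8 in sum8.
suff [r r3 rP] : exists2 r, (r < 3)%N & balanced G (recolor f s r) ->
    (2%N \in profile (recolor f s r) G) = b.
  exists (recolor f s r); split=> //; first exact: fair_recolor.
  by move=> g; rewrite /recolor; case: ifP.
rewrite /balanced /profile /=.
have E r := size_recolor f r _ uG sG.
suff /hasP[r] : has (fun r => let l := [:: size (cls f 0%N (minus G [:: s])) + (r == 0);
      size (cls f 1%N (minus G [:: s])) + (r == 1);
      size (cls f 2%N (minus G [:: s])) + (r == 2)]%N in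
    all (fun k => 1 < k < 5)%N l ==> ((2%N \in l) == b)) (iota 0 3).
  rewrite mem_iota => r3 /implyP rP; exists r => //.
  by rewrite !E => bal; apply/eqP; apply: rP.
move: (size (cls f 0%N _)) (size (cls f 1%N _)) (size (cls f 2%N _)) sum8 => x y z xyz.
have [x9 y9 z9] : [/\ (x < 9)%N, (y < 9 - x)%N & z = 8 - x - y]%N by split; lia.
rewrite {z xyz}z9.
(* Three sizes with sum 8 leave finitely many cases, and a suitable class [r] is found by
   computation in each. *)
have /allP/(_ x) : all (fun x => all (fun y => has (fun r =>
    let l := [:: x + (r == 0); y + (r == 1); 8 - x - y + (r == 2)]%N in
    all (fun k => 1 < k < 5)%N l ==> ((2%N \in l) == b)) (iota 0 3))
    (iota 0 (9 - x))) (iota 0 9) by case: b; vm_compute.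
rewrite mem_iota x9 => /(_ isT) /allP/(_ y); rewrite mem_iota y9 => /(_ isT).
by [].
Qed.
Lemma trio_flags (G : seq nat) a b c fa fb fc : sorted ltn G -> size G = 9%N ->
  uniq [:: a; b; c] -> fair a 3 G fa -> fair b 3 G fb -> fair c 3 G fc ->
  (forall g, (fa g < 3)%N) -> (forall g, (fb g < 3)%N) -> (forall g, (fc g < 3)%N) ->
  (balanced G fa -> balanced G fb -> balanced G fc ->
   ((2%N \in profile fa G) + (2%N \in profile fb G) + (2%N \in profile fc G) != 1)%N) ->
  satisfiable [:: a; b; c] G.
Proof.
move=> sG G9 uabc Fa Fb Fc fa3 fb3 fc3 not1.
have uG := sorted_uniq ltn_trans ltnn sG.
have [//|[Ba Bb Bc E]] := trio_sat uG sG uabc G9 Fa Fb Fc fa3 fb3 fc3.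
by have := not1 Ba Bb Bc; rewrite E.
Qed.

(** The good [g0] is given away so that the number of agents with a pair among the other three is
    not 1. An agent refusing [g0] can adjust its own colouring. If nobody refuses, any of the four
    may be the one to leave. *)
Lemma four_agents_single (N : seq I) g0 (G : seq nat) i : uniq N -> size N = 4%N ->
  sorted ltn (g0 :: G) -> size G = 9%N -> {in N, forall j, splits j 4 (g0 :: G)} ->
  i \in N -> t i <= v i g0 -> satisfiable N (g0 :: G).
Proof.
move=> uN N4 sgG G9 sp iN ig.
have uG := sorted_uniq ltn_trans ltnn sgG.
have g0G : g0 \notin G by case/andP: uG.
have sG : sorted ltn G by apply: path_sorted sgG.
have uG' : uniq G by case/andP: uG.
have rest : minus (g0 :: G) [:: g0] = G.
  rewrite /= inE eqxx /=; apply/all_filterP/allP => g gG.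
  by rewrite inE; apply: contraNneq g0G => <-.
have give e a b c : perm_eq [:: e; a; b; c] N -> t e <= v e g0 ->
    (uniq [:: a; b; c] -> satisfiable [:: a; b; c] G) -> satisfiable N (g0 :: G).
  move=> pN eg sat; have uE : uniq [:: e; a; b; c] by rewrite (perm_uniq pN).
  have eN : e \in N by rewrite -(perm_mem pN) mem_head.
  apply: (satisfiable_give (S := [:: g0]) eN).
    by rewrite value_single ?mem_head.
  rewrite rest; have /andP[eabc uabc] := uE.
  apply: satisfiable_perm (sat uabc) => j; rewrite mem_filter -(perm_mem pN) [in RHS]in_cons.
  by have [->|je] := eqVneq j e => /=; rewrite ?(negPf eabc).
have coloring j : j \in N -> exists f, fair j 3 G f /\ forall g, (f g < 3)%N.
  move=> jN; apply: fair_total => //; rewrite -rest.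
  by apply: (@splits_small _ 4) => //; apply: sp.
have free j (b : bool) : j \in N -> v j g0 < t j -> exists f,
    [/\ fair j 3 G f, forall g, (f g < 3)%N & balanced G f -> (2%N \in profile f G) = b].
  move=> jN jg; have [f [fair_f f4]] := @fair_total j 4 _ isT (sp j jN).
  (* As [g0] alone is not enough for [j], its class contains another good [s]. Dropping this class
     leaves three fair classes that avoid [s], which is therefore spare. *)
  have /hasP[s sG' /eqP fs] : has (fun s => f s == f g0) G.
    rewrite has_filter; apply/eqP => E; have := fair_f (f g0) (f4 g0).
    by rewrite /= eqxx E value_cons value_nil addr0 leNgt jg.
  have /(@fair_total j 3 _ isT)[f' [fair_f' f'3]] : splits j 3 (minus G [:: s]).
    have -> : minus G [:: s] = minus (g0 :: G) [:: g0; s].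
      rewrite -{1}rest -filter_predI; apply: eq_filter => g /=.
      by rewrite !inE negb_or andbC.
    apply: (splits_drop (k := 4) (f4 g0)) => [d d4 _|g]; first exact: fair_f.
    by rewrite !inE => /orP[] /eqP ->.
  exact: (spare_good uG' sG' G9 fair_f' f'3 b).
have [/hasP[d dN dg]|/hasPn all_like] := boolP (has (fun d => v d g0 < t d) N).
  have : d != i by apply: contraTneq dg => ->; rewrite -leNgt.
  move=> di; have diN : d \in rem i N by rewrite mem_rem_uniq // !inE di.
  have pN := perm_to_rem iN; have pN' := perm_to_rem diN.
  case E : (rem d (rem i N)) pN' => [|x [|y [|]]] pN';
    have := perm_size pN; have := perm_size pN'; rewrite /= size_rem // N4 //.
  move=> _ _; have pN4 : perm_eq [:: i; d; x; y] N.
    by rewrite perm_sym (perm_trans pN) // perm_cons.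
  have inN z : z \in [:: i; d; x; y] -> z \in N by rewrite (perm_mem pN4).
  apply: (give i d x y pN4 ig) => udxy.
  have [fx [Fx fx3]] : exists f, fair x 3 G f /\ forall g, (f g < 3)%N.
    by apply/coloring/inN; rewrite !inE eqxx !orbT.
  have [fy [Fy fy3]] : exists f, fair y 3 G f /\ forall g, (f g < 3)%N.
    by apply/coloring/inN; rewrite !inE eqxx !orbT.
  (* Agent [d] has a pair exactly if [x] or [y] has one, so the count is 0, 2 or 3, provided the
     colouring of [d] is balanced. *)
  have [fd [Fd fd3 dP]] :=
    free d ((2%N \in profile fx G) || (2%N \in profile fy G)) dN dg.
  apply: (trio_flags sG G9 udxy Fd Fx Fy) => // /dP -> _ _.
  by case: (2%N \in profile fx G); case: (2%N \in profile fy G).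
have likes j : j \in N -> t j <= v j g0 by move=> /all_like; rewrite -leNgt.
case: N uN N4 sp iN coloring give likes {free all_like} =>
  [|a [|b [|c [|d [|]]]]] // _ _ _ _ coloring give likes.
have [aN bN cN dN] : [/\ a \in [:: a; b; c; d], b \in [:: a; b; c; d],
    c \in [:: a; b; c; d] & d \in [:: a; b; c; d]].
  by split; rewrite !inE eqxx ?orbT.
have [fa [Fa fa3]] := coloring a aN; have [fb [Fb fb3]] := coloring b bN.
have [fc [Fc fc3]] := coloring c cN; have [fd [Fd fd3]] := coloring d dN.
have pa : perm_eq [:: a; b; c; d] [:: a; b; c; d] by [].
have pb : perm_eq [:: b; a; c; d] [:: a; b; c; d].
  by apply/permP => p /=; do 4!case: (p _).
have pc : perm_eq [:: c; a; b; d] [:: a; b; c; d].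
  by apply/permP => p /=; do 4!case: (p _).
have pd : perm_eq [:: d; a; b; c] [:: a; b; c; d].
  by apply/permP => p /=; do 4!case: (p _).
have Ga := give a b c d pa (likes a aN); have Gb := give b a c d pb (likes b bN).
have Gc := give c a b d pc (likes c cN); have Gd := give d a b c pd (likes d dN).
have Ta u := trio_flags sG G9 u Fb Fc Fd fb3 fc3 fd3.
have Tb u := trio_flags sG G9 u Fa Fc Fd fa3 fc3 fd3.
have Tc u := trio_flags sG G9 u Fa Fb Fd fa3 fb3 fd3.
have Td u := trio_flags sG G9 u Fa Fb Fc fa3 fb3 fc3.
(* With exactly one pair owner among the four, that agent leaves; with exactly two, an agent without
   a pair leaves; otherwise anyone may. *)
move: Ta Tb Tc Td; case: (2%N \in profile fa G); case: (2%N \in profile fb G);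
case: (2%N \in profile fc G); case: (2%N \in profile fd G) => Ta Tb Tc Td;
by [apply: Ga => u; apply: Ta | apply: Gb => u; apply: Tb |
    apply: Gc => u; apply: Tc | apply: Gd => u; apply: Td].
Qed.

Lemma solvable4 : solvable 4 10.
Proof.
apply: solvable_pair => //; first exact: (solvable_plus5 (n := 3)).
move=> N G i g uN N4 sG G10 sp iN gG ig.
have [G9|G9] := leqP (size G) 9.
  by apply: (@satisfiable_single 4 9 N G i g) => //; apply: (solvable_plus5 (n := 3)).
case: G sG G10 sp gG G9 => [|g0 G] // sG G10 sp gG G9.
apply: (four_agents_single (i := i)) => //; first by apply/eqP; rewrite eqn_leq -ltnS G10.
(* Whoever accepts [g] also accepts the best good [g0]. *)
apply: le_trans ig (v_anti _ _).
move: gG; rewrite inE => /orP[/eqP -> //|gG].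
by move: sG; rewrite /= (path_sortedE ltn_trans) => /andP[/allP/(_ g gG)/ltnW].
Qed.

(** The counting condition now reads $n^2 > 3n + 2$, true from $n = 4$ on; the induction restarts at
    [solvable4], beyond the excluded case. *)
Lemma solvable_plus6 n : (0 < n)%N -> n != 3%N -> solvable n (n + 6).
Proof.
elim: n => // [[|[|[|[|n]]]]] IH _ n3 //; [exact: solvable1|exact: solvable2|exact: solvable4|].
apply: solvable_step => //; first by rewrite /=; nia.
by have := IH isT isT; rewrite !addSn.
Qed.
End Goods.

(** * Reduction to ordered instances *)

Section Ordering.

Variables (R : realFieldType) (n m : nat) (v : valuation R n m).
Hypothesis v_ge0 : forall i g, 0 <= v i g.

Definition ranking (i : 'I_n) : seq 'I_m :=
  sort (fun x y => v i y <= v i x) (enum 'I_m).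

(** The default value 0 beyond the last good keeps the sequence nonincreasing on all of [nat]. *)
Definition ranked (i : 'I_n) (k : nat) : R := nth 0 (map (v i) (ranking i)) k.

Lemma size_ranking i : size (ranking i) = m.
Proof. by rewrite size_sort size_enum_ord. Qed.

Lemma ranked_ge0 i k : 0 <= ranked i k.
Proof.
rewrite /ranked; have [km|mk] := ltnP k (size (map (v i) (ranking i))); last first.
  by rewrite nth_default.
by have /mapP[g _ ->] := mem_nth 0 km.
Qed.

Lemma ranked_anti i k l : (k <= l)%N -> ranked i l <= ranked i k.
Proof.
move=> kl; rewrite {1}/ranked.
have [lm|ml] := ltnP l (size (map (v i) (ranking i))); last first.
  by rewrite nth_default // ranked_ge0.
have sorted_v : sorted (fun x y : R => y <= x) (map (v i) (ranking i)).
  by rewrite sorted_map; apply: sort_sorted => x y; apply: le_total.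
have tr : transitive (fun x y : R => y <= x) by move=> y x z yx zy; apply: le_trans yx.
apply: (sorted_leq_nth tr (fun x => lexx x) 0 sorted_v) => //.
by rewrite inE; apply: leq_ltn_trans lm.
Qed.

Lemma sum_positions (T : Type) (s : seq T) (o : T -> nat) (w : T -> R) c :
  \sum_(k <- iota 0 (size s) | nth 0%N (map o s) k == c) nth 0 (map w s) k =
  \sum_(g <- s | o g == c) w g.
Proof.
elim: s => [|g s IH]; first by rewrite !big_nil.
rewrite /= !big_cons /= -IH (iotaDl 1 0) !big_map.
by case: ifP.
Qed.

Lemma splits_ranked i : splits ranked (mms v) i n (iota 0 m).
Proof.
rewrite /splits /fair /mms.
(* Being guaranteed by some colouring holds for 0 and passes to the larger of two values, so no
   optimal allocation has to be selected. *)
elim/big_ind: _ => [|x y [f fP] [g gP]|A].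
- by exists (fun=> 0%N) => c _; apply: sumr_ge0 => k _; apply: ranked_ge0.
- by case: (leP x y) => _; [exists g|exists f].
case/andP=> /forallP disj _.
pose o g := if [pick j | g \in A j] is Some j then nat_of_ord j else 0%N.
have oP g j : g \in A j -> o g = j.
  rewrite /o => gj; case: pickP => [l gl|/(_ j)]; last by rewrite gj.
  have /forallP/(_ j)/implyP := disj l; have [-> //|lj /(_ isT)] := eqVneq l j.
  by rewrite disjoint_subset => /subsetP/(_ g gl); rewrite inE /= gj.
exists (fun k => nth 0%N (map o (ranking i)) k) => c cn.
rewrite /value big_filter -[in iota _ _](size_ranking i) sum_positions.
rewrite (perm_big (enum 'I_m)) ?perm_sort // big_enum_cond /=.
pose j := Ordinal cn; apply: le_trans (_ : bundle_value v i (A j) <= _).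
  by rewrite /min_share; apply: bigmin_le.
rewrite /bundle_value big_mkcond [leRHS]big_mkcond; apply: ler_sum => g _.
case: ifP => [/oP -> /=|_]; first by rewrite eqxx.
by case: ifP.
Qed.

(* When agent [h k] picks after [k] others, one of its [k + 1] favourite goods
   is left. *)
Lemma picking_sequence (h : nat -> 'I_n) k : (k <= m)%N ->
  exists s : seq 'I_m, [/\ uniq s, size s = k &
    {in s, forall g, ranked (h (index g s)) (index g s) <= v (h (index g s)) g}].
Proof.
elim: k => [|k IH] km; first by exists [::].
have [s [us sk sP]] := IH (ltnW km).
have szt : size (take k.+1 (ranking (h k))) = k.+1.
  by rewrite size_takel ?size_ranking.
have [/hasP[g gt gs]|/hasPn all_s] := boolP (has (fun g => g \notin s) (take k.+1 (ranking (h k)))).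
  exists (rcons s g); split; rewrite ?rcons_uniq ?gs ?size_rcons ?sk // => x.
  rewrite mem_rcons inE -cats1 => /orP[/eqP ->|xs]; last by rewrite index_cat xs sP.
  rewrite index_cat (negPf gs) /= eqxx addn0 sk.
  have gr := mem_take gt; have gi : (index g (ranking (h k)) <= k)%N.
    have := gt; rewrite -index_mem szt ltnS -{2}(cat_take_drop k.+1 (ranking (h k))).
    by rewrite index_cat gt.
  apply: le_trans (ranked_anti _ gi) _.
  by rewrite /ranked (nth_map g) ?index_mem // nth_index.
have : (size (take k.+1 (ranking (h k))) <= size s)%N.
  apply: uniq_leq_size; first by rewrite take_uniq // sort_uniq enum_uniq.
  by move=> g /all_s; rewrite negbK.
by rewrite szt sk ltnn.
Qed.

Lemma map_index_iota (T : eqType) (s : seq T) : uniq s ->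
  [seq index g s | g <- s] = iota 0 (size s).
Proof.
case: s => // x s us; apply: (@eq_from_nth _ 0%N); rewrite size_map ?size_iota // => k ks.
by rewrite (nth_map x) // nth_iota // index_uniq.
Qed.

(** The owner of the good of rank [k] in the ordered instance makes pick number [k] in the original
    one, and [index g s] is the moment when [g] is picked. *)
Lemma allocation_of_picks (h : nat -> 'I_n) :
  (forall i, mms v i <= value ranked i (cls h i (iota 0 m))) ->
  exists A : {ffun 'I_n -> {set 'I_m}}, is_MMS_allocation v A.
Proof.
move=> hP; have [s [us sm sP]] := picking_sequence h (leqnn m).
have s_all g : g \in s.
  have sub : {subset s <= enum 'I_m} by move=> x _; rewrite mem_enum.
  have [|_ ->] := uniq_min_size us sub; last by rewrite mem_enum.
  by rewrite sm size_enum_ord.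
pose A := [ffun i : 'I_n => [set g | h (index g s) == i]].
exists A; split.
  apply/andP; split.
    apply/forallP => i; apply/forallP => j; apply/implyP => ij.
    rewrite disjoint_subset; apply/subsetP => g; rewrite !ffunE !inE => /eqP ->.
    exact: ij.
  apply/eqP/setP => g; rewrite inE; apply/bigcupP; exists (h (index g s)) => //.
  by rewrite ffunE inE.
move=> i; apply: le_trans (hP i) _.
rewrite /value big_filter -[in iota _ _]sm -(map_index_iota us) big_map.
have -> : bundle_value v i (A i) = \sum_(g <- s | h (index g s) == i) v i g.
  rewrite (perm_big (enum 'I_m)) ?big_enum_cond /=; last first.
    by apply: uniq_perm; rewrite ?enum_uniq // => g; rewrite s_all mem_enum.
  by apply: eq_bigl => g; rewrite ffunE inE.
rewrite big_seq_cond [leRHS]big_seq_cond; apply: ler_sum => g /andP[gs /eqP <-].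
exact: sP.
Qed.

End Ordering.

Theorem theorem2 (R : realFieldType) (n m : nat) (v : valuation R n m) :
  (0 < n)%N -> n <> 3%N -> (m <= n + 6)%N ->
  (forall (i : 'I_n) (g : 'I_m), 0 <= v i g) ->
  exists A : {ffun 'I_n -> {set 'I_m}}, is_MMS_allocation v A.
Proof.
move=> n0 /eqP n3 mn v_ge0.
have [h hP] : satisfiable (ranked v) (mms v) (enum 'I_n) (iota 0 m).
  apply: (solvable_plus6 (ranked_ge0 v_ge0) (ranked_anti v_ge0) n0 n3).
  - exact: enum_uniq.
  - by rewrite size_enum_ord.
  - exact: iota_ltn_sorted.
  - by rewrite size_iota.
  - by move=> i _; apply: splits_ranked.
by apply: (allocation_of_picks v_ge0 (h := h)) => i; apply: hP; rewrite mem_enum.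
Qed.
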